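(* Let $\mathcal X\subset\mathbb R^n$ be a nonempty closed convex set, $\|\cdot\|$ a norm on $\mathbb R^n$ with conjugate norm $\|\cdot\|_*$, and $h$ an $\mathcal X$-regularizer that is strongly convex (with modulus 1) with respect to $\|\cdot\|$. Let $L>0$ and let $f:\mathbb R^n\to\mathbb R\cup\{+\infty\}$ be a convex function, continuously differentiable on $\mathcal X$, with $\|\nabla f(x)-\nabla f(x')\|_*\le L\|x-x'\|$ for all $x,x'\in\mathcal X$. Assume that $f$ attains its minimum $f_*$ over $\mathcal X$ at some $x_*\in\mathcal X$, and that $x_*\in\operatorname{dom}h$. Let $(\gamma_t)_{t\ge1}$ be positive step-sizes and let $(x_t,\vartheta_t)_{t\ge1}$ be UMD$(h,\xi)$ iterates with $\xi:=(-\gamma_t\nabla f(x_t))_{t\ge1}$. Assume that the step-sizes are chosen in such a way that $$\gamma_tD_f(x_{t+1},x_t)\le D_h(x_{t+1},x_t;\vartheta_t)\qquad(\star)$$ is satisfied for all $t\ge1$; condition $(\star)$ always holds when $\gamma_t\le1/L$. Then for all $T\ge1$, $$f(x_{T+1})-f_*\le\Big(\sum_{t=1}^T\gamma_t\Big)^{-1}D_h(x_*,x_1;\vartheta_1).$$ In particular, for constant step-sizes $\gamma_t\equiv\gamma=1/L$, $$f(x_{T+1})-f_*\le\frac{L\,D_h(x_*,x_1;\vartheta_1)}{T}.$$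
   Context: $\langle\cdot,\cdot\rangle$ is the canonical scalar product on $\mathbb R^n$; $\|\vartheta\|_*=\max_{\|x\|\le1}\langle\vartheta,x\rangle$. For convex $g:\mathbb R^n\to\mathbb R\cup\{+\infty\}$: $\operatorname{dom}g=\{x:g(x)<\infty\}$; $\partial g(x)$ is the set of $\vartheta\in\mathbb R^n$ with $g(x')-g(x)\ge\langle\vartheta,x'-x\rangle$ for all $x'\in\mathbb R^n$; $g^*(\vartheta)=\sup_{x}\{\langle\vartheta,x\rangle-g(x)\}$; for $\vartheta\in\partial g(x)$, the Bregman divergence with subgradient $\vartheta$ is $D_g(x',x;\vartheta)=g(x')-g(x)-\langle\vartheta,x'-x\rangle$; if $g$ is differentiable at $x$, $D_g(x',x)=D_g(x',x;\nabla g(x))$. $g$ is strongly convex (modulus 1) w.r.t. $\|\cdot\|$ if $g(\lambda x+(1-\lambda)x')\le\lambda g(x)+(1-\lambda)g(x')-\frac{\lambda(1-\lambda)}2\|x'-x\|^2$ for all $x,x'\in\mathbb R^n$, $\lambda\in[0,1]$. An $\mathcal X$-regularizer is a function $h:\mathbb R^n\to\mathbb R\cup\{+\infty\}$ that is strictly convex, lower-semicontinuous, with $\operatorname{cl}\operatorname{dom}h=\mathcal X$ and $\operatorname{dom}h^*=\mathbb R^n$; then $h^*$ is differentiable on $\mathbb R^n$. UMD$(h,\xi)$ iterates: a sequence $(x_t,\vartheta_t)_{t\ge1}$ in $\mathbb R^n\times\mathbb R^n$ such that for all $t\ge1$: $x_t=\nabla h^*(\vartheta_t)$, and $\langle\vartheta_{t+1}-\vartheta_t-\xi_t,\,x-x_{t+1}\rangle\ge0$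 for all $x\in\mathcal X$. One has $\vartheta_t\in\partial h(x_t)$ (equivalent to $x_t=\nabla h^*(\vartheta_t)$) and $x_t\in\operatorname{dom}h\subset\mathcal X$. *)

(* Defs.v *)
From HB Require Import structures.
From mathcomp Require Import all_boot all_order all_algebra.
From mathcomp Require Import all_classical all_reals all_analysis.

Set Implicit Arguments.
Unset Strict Implicit.
Unset Printing Implicit Defensive.

Import Order.TTheory GRing.Theory Num.Theory.
Import numFieldNormedType.Exports.

Local Open Scope classical_set_scope.
Local Open Scope ring_scope.

(* Functions with values in R U {+oo} are the maps g : 'rV[R]_n -> \bar R that
   satisfy [proper_valued g]. *)

Section Definitions.
Context {R : realType} {n : nat}.
Implicit Types (g h : 'rV[R]_n -> \bar R) (x y theta : 'rV[R]_n).
Implicit Types (X : set 'rV[R]_n) (N : 'rV[R]_n -> R).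

Definition dotp (u v : 'rV[R]_n) : R := \sum_(i < n) u 0 i * v 0 i.

(* An arbitrary norm on R^n. The topology of 'rV[R]_n is induced by the
   library's max norm; all norms on R^n induce the same topology. *)
Definition is_norm N : Prop :=
  [/\ forall x y, N (x + y) <= N x + N y,
      forall (a : R) x, N (a *: x) = `|a| * N x &
      forall x, N x = 0 -> x = 0].

(* The set is nonempty and compact when N is a norm, so this real-valued
   supremum is a maximum. *)
Definition dual_norm N theta : R := sup [set dotp theta x | x in [set x | N x <= 1]].

Definition proper_valued g : Prop := forall x, (-oo < g x)%E.

Definition dom g : set 'rV[R]_n := [set x | (g x < +oo)%E].

(* In the next two definitions the library convention 0 * +oo = 0 makes the
   cases l = 0 and l = 1 trivially true. *)
Definition convex_fun g : Prop :=
  forall x y (l : R), 0 <= l <= 1 ->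
    (g (l *: x + (1 - l) *: y)%R <= l%:E * g x + (1 - l)%:E * g y)%E.

Definition strongly_convex N g : Prop :=
  forall x y (l : R), 0 <= l <= 1 ->
    (g (l *: x + (1 - l) *: y)%R <=
     l%:E * g x + (1 - l)%:E * g y
     - (l * (1 - l) / 2 * N (y - x) ^+ 2)%:E)%E.

(* Strictness is only required on the domain: elsewhere the right-hand side is
   +oo and the left-hand side may be +oo as well. *)
Definition strictly_convex g : Prop :=
  forall x y (l : R), dom g x -> dom g y -> x != y -> 0 < l < 1 ->
    (g (l *: x + (1 - l) *: y)%R < l%:E * g x + (1 - l)%:E * g y)%E.

Definition conjugate g theta : \bar R :=
  ereal_sup (range (fun x => ((dotp theta x)%:E - g x)%E)).

(* Only meaningful at points where [differentiable_at] holds. *)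
Definition grad g x : 'rV[R]_n :=
  \row_(i < n) 'D_(delta_mx 0 i) (fine \o g) x.

(* Finiteness near x is required because [fine] sends +oo to 0. *)
Definition differentiable_at g x : Prop :=
  (\forall y \near x, g y \is a fin_num) /\ differentiable (fine \o g) x.

Definition continuously_differentiable_on X g : Prop :=
  (forall x, X x -> differentiable_at g x) /\ {within X, continuous (grad g)}.

(* Bregman divergence D_g(y, x; theta) *)
Definition bregman_sub g y x theta : \bar R :=
  (g y - g x - (dotp theta (y - x)%R)%:E)%E.

Definition bregman g y x : \bar R := bregman_sub g y x (grad g x).

Definition regularizer X h : Prop :=
  [/\ proper_valued h, strictly_convex h, lower_semicontinuous h,
      closure (dom h) = X & dom (conjugate h) = setT].

(* Sequences are indexed from 1; the terms of index 0 are irrelevant. *)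
Definition umd_iterates X h (xi x theta : nat -> 'rV[R]_n) : Prop :=
  forall t, (1 <= t)%N ->
    x t = grad (conjugate h) (theta t) /\
    forall z, X z ->
      0 <= dotp (theta t.+1 - theta t - xi t) (z - x t.+1).

End Definitions.

(* Main.v *)
Require Import Defs.
From HB Require Import structures.
From mathcomp Require Import all_boot all_order all_algebra.
From mathcomp Require Import all_classical all_reals all_analysis.
From mathcomp Require Import ring lra.

Set Implicit Arguments.
Unset Strict Implicit.
Unset Printing Implicit Defensive.

Import Order.TTheory GRing.Theory Num.Theory.
Import numFieldNormedType.Exports.

Local Open Scope classical_set_scope.
Local Open Scope ring_scope.

(** Strong convexity and lower semicontinuity make [h - <theta, .>] attain its
    minimum at a unique point [y], with quadratic growth [N(x - y)^2 / 2]; this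
    [y] is the gradient of [h^*] at [theta], so that
    [D_h(z, x_t; theta_t) >= N(z - x_t)^2 / 2 >= 0] for all [z] in [dom h].
    Condition (star), the gradient inequality for [f] at [x_t], the variational
    inequality of the iterates and the three-point identity give
    [gamma_t (f(x_{t+1}) - f(z)) <= d_t - d_{t+1}], where
    [d_t = D_h(z, x_t; theta_t)].
    With [z = x_t] this says that [f(x_t)] is nonincreasing, and with
    [z = xstar] the right-hand side telescopes.  For [gamma_t <= 1/L],
    (star) holds because [D_f(y, x) <= L N(y - x)^2 / 2]. *)

(** * The scalar product and its bounds *)

Section ScalarProduct.
Context {R : realType} {n : nat}.
Implicit Types (u v w : 'rV[R]_n) (a : R).

Lemma dotpC u v : dotp u v = dotp v u.
Proof. by apply: eq_bigr => i _; rewrite mulrC. Qed.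

Lemma dotpDr u v w : dotp u (v + w) = dotp u v + dotp u w.
Proof. by rewrite -big_split; apply: eq_bigr => i _; rewrite mxE mulrDr. Qed.

Lemma dotpZr a u v : dotp u (a *: v) = a * dotp u v.
Proof. by rewrite mulr_sumr; apply: eq_bigr => i _; rewrite mxE mulrCA. Qed.

Lemma dotp0r u : dotp u 0 = 0.
Proof. by rewrite -(scale0r 0) dotpZr mul0r. Qed.

Lemma dotpBr u v w : dotp u (v - w) = dotp u v - dotp u w.
Proof. by rewrite dotpDr -scaleN1r dotpZr mulN1r. Qed.

Lemma dotpDl u v w : dotp (u + v) w = dotp u w + dotp v w.
Proof. by rewrite ![dotp _ w]dotpC dotpDr. Qed.

Lemma dotpZl a u v : dotp (a *: u) v = a * dotp u v.
Proof. by rewrite ![dotp _ v]dotpC dotpZr. Qed.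

Lemma dotpBl u v w : dotp (u - v) w = dotp u w - dotp v w.
Proof. by rewrite ![dotp _ w]dotpC dotpBr. Qed.

Lemma dotp_delta (i : 'I_n) u : dotp (delta_mx 0 i) u = u 0 i.
Proof.
rewrite /dotp (bigD1 i)//= mxE !eqxx mul1r big1 ?addr0// => j /negbTE ji.
by rewrite mxE ji andbF mul0r.
Qed.

Lemma coord_le_norm u (i : 'I_n) : `|u 0 i| <= `|u|.
Proof.
rewrite [leRHS]/Num.norm /= mx_normrE.
by apply/bigmax_geP; right; exists (0, i).
Qed.

(** Hölder's inequality for the max norm, with the l^1 norm of [u] as constant. *)
Lemma dotp_bounded u : exists2 C, 0 <= C & forall v, `|dotp u v| <= C * `|v|.
Proof.
exists (\sum_(i < n) `|u 0 i|); first exact: sumr_ge0.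
move=> v; apply: le_trans (ler_norm_sum _ _ _) _; rewrite mulr_suml.
by apply: ler_sum => i _; rewrite normrM ler_wpM2l// coord_le_norm.
Qed.

End ScalarProduct.

(** * Equivalence of an arbitrary norm with the max norm, and the dual norm *)

Section Norms.
Context {R : realType} {n : nat} (N : 'rV[R]_n -> R) (N_norm : is_norm N).
Implicit Types (u v x y : 'rV[R]_n).

Lemma is_norm0 : N 0 = 0.
Proof. by case: N_norm => _ NZ _; rewrite -(scale0r 0) NZ normr0 mul0r. Qed.

Lemma is_normN x : N (- x) = N x.
Proof. by case: N_norm => _ NZ _; rewrite -scaleN1r NZ normrN1 mul1r. Qed.

Lemma is_normC x y : N (x - y) = N (y - x).
Proof. by rewrite -is_normN opprB. Qed.

Lemma is_norm_ge0 x : 0 <= N x.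
Proof.
case: N_norm => ND _ _; have := ND x (- x).
by rewrite subrr is_norm0 is_normN; lra.
Qed.

(** Expand [x] in the standard basis: each coordinate is at most the max norm, which leaves the sum
    of the norms of the basis vectors as constant. *)
Lemma is_norm_le : exists2 C, 0 <= C & forall x, N x <= C * `|x|.
Proof.
case: N_norm => ND NZ _; exists (\sum_(i < n) N (delta_mx 0 i)).
  by apply: sumr_ge0 => i _; exact: is_norm_ge0.
move=> x; rewrite mulr_suml {1}[x]row_sum_delta.
elim/big_ind2: _ => [|a b c d ab cd|i _]; first by rewrite is_norm0.
  exact: le_trans (ND _ _) (lerD ab cd).
by rewrite NZ mulrC ler_wpM2l ?is_norm_ge0// coord_le_norm.
Qed.

Lemma is_norm_continuous : continuous N.
Proof.
case: N_norm => ND _ _; have [C C0 NC] := is_norm_le.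
move=> x; apply/(@cvgrPdist_le _ _ _ _ (nbhs_filter x)) => e e0.
(* [C] may vanish, so [C + 1] is used as divisor. *)
have C1 : 0 < C + 1 by lra.
near=> y.
have -> : `|N x - N y| = `|N y - N x| by rewrite distrC.
have H z w : N z - N w <= C * `|z - w|.
  apply: le_trans (NC _); have := ND (z - w) w; rewrite subrK; lra.
have H2 : C * `|x - y| <= e.
  have : `|x - y| <= e / (C + 1).
    near: y; move/cvgrPdist_le : (@cvg_id _ (nbhs x)); apply.
    exact: divr_gt0.
  rewrite ler_pdivlMr// mulrC mulrDl mul1r; have := normr_ge0 (x - y); lra.
rewrite ler_norml; have := H x y; have := H y x; rewrite [`|y - x|]distrC.
by move=> *; apply/andP; split; lra.
Unshelve. all: by end_near. Qed.

(** By compactness, [N] attains a positive minimum on the unit sphere of the max norm; homogeneity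
    makes the inverse of this minimum a valid constant. *)
Lemma norm_le_is_norm : exists2 c, 0 < c & forall x, `|x| <= c * N x.
Proof.
case: (N_norm) => _ NZ Nd.
(* The sphere is empty when [n = 0]; the extreme value theorem needs it nonempty. *)
have [S0|/set0P Sn0] := eqVneq [set x : 'rV[R]_n | `|x| = 1] set0.
  exists 1 => // x; have [->|x0] := eqVneq x 0.
    by rewrite normr0 is_norm0 mulr0.
  suff : [set x : 'rV[R]_n | `|x| = 1] (`|x|^-1 *: x) by rewrite S0.
  by rewrite /= normrZ normfV normr_id mulVf// normr_eq0.
have Sc : compact [set x : 'rV[R]_n | `|x| = 1].
  apply: bounded_closed_compact.
    by exists 1; split => // M M1 x /= ->; exact: ltW.
  rewrite (_ : mkset _ = (@Num.norm R 'rV[R]_n) @^-1` [set 1])//.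
  by apply: closed_comp => [x _|]; [exact: norm_continuous|exact: closed_eq].
have Nc : {within [set x : 'rV[R]_n | `|x| = 1], continuous N}.
  exact/continuous_subspaceT/is_norm_continuous.
have [z /[!inE]/= z1 zmin] := EVT_min_rV Sn0 Sc Nc.
have Nz : 0 < N z.
  rewrite lt_neqAle is_norm_ge0 andbT eq_sym; apply/eqP => /Nd z0.
  by move: z1; rewrite z0 normr0 => /esym/eqP; rewrite oner_eq0.
exists (N z)^-1 => [|x]; first by rewrite invr_gt0.
have [->|x0] := eqVneq x 0; first by rewrite normr0 is_norm0 mulr0.
have nx : 0 < `|x| by rewrite normr_gt0.
rewrite ler_pdivlMl// mulrC -ler_pdivlMl// -[_^-1]gtr0_norm ?invr_gt0// -NZ.
by apply: zmin; rewrite inE /= normrZ gtr0_norm ?invr_gt0// mulVf ?gt_eqF.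
Qed.

Lemma dotp_is_norm_bounded u :
  exists2 C, 0 <= C & forall v, `|dotp u v| <= C * N v.
Proof.
have [C C0 dC] := dotp_bounded u; have [c c0 Nc] := norm_le_is_norm.
exists (C * c) => [|v]; first exact: mulr_ge0 (ltW c0).
by apply: le_trans (dC v) _; rewrite -mulrA ler_wpM2l.
Qed.

(** Homogeneity reduces the bound to the unit vector [v / N v]. The real [sup] dominates its
    elements because the linear form is bounded on the unit ball of [N]. *)
Lemma dotp_le_dual_norm u v : dotp u v <= dual_norm N u * N v.
Proof.
case: (N_norm) => _ NZ Nd.
have [v0|v0] := eqVneq v 0.
  by rewrite v0 is_norm0 mulr0 dotp0r.
have Nv : 0 < N v.
  by rewrite lt_neqAle is_norm_ge0 andbT eq_sym; apply: contra_neq v0 => /Nd.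
rewrite -ler_pdivrMr// mulrC -dotpZr; apply: ub_le_sup.
  have [C C0 dC] := dotp_is_norm_bounded u.
  exists C => _ [w /= w1 <-]; apply: le_trans (ler_norm _) _.
  by apply: le_trans (dC w) _; rewrite ler_piMr.
exists ((N v)^-1 *: v) => //=.
by rewrite NZ gtr0_norm ?invr_gt0// mulVf ?gt_eqF.
Qed.

End Norms.

(** * Minimizers of [h - <theta, .>] for strongly convex [h] *)

Section Conjugate.
Context {R : realType} {n : nat} (N : 'rV[R]_n -> R) (h : 'rV[R]_n -> \bar R).
Hypotheses (N_norm : is_norm N) (h_proper : proper_valued h).
Implicit Types (x y z theta v : 'rV[R]_n).

Lemma dom_fin_num x : dom h x -> h x \is a fin_num.
Proof. by move=> xh; rewrite fin_numElt h_proper. Qed.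

Lemma dom_fineK x : dom h x -> (fine (h x))%:E = h x.
Proof. by move=> /dom_fin_num/fineK. Qed.

Lemma fenchel_young theta x : ((dotp theta x)%:E - h x <= conjugate h theta)%E.
Proof. by apply: ereal_sup_ubound; exists x. Qed.

Hypothesis h_convex : strongly_convex N h.

Lemma strongly_convex_fine x y (l : R) : 0 <= l <= 1 -> dom h x -> dom h y ->
  dom h (l *: x + (1 - l) *: y) /\
  fine (h (l *: x + (1 - l) *: y)) <=
    l * fine (h x) + (1 - l) * fine (h y) - l * (1 - l) / 2 * N (y - x) ^+ 2.
Proof.
move=> l01 xh yh; have hle := h_convex x y l01.
rewrite -(dom_fineK xh) -(dom_fineK yh) -!EFinM -EFinD in hle.
have zh : dom h (l *: x + (1 - l) *: y) by apply: le_lt_trans hle (ltry _).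
by split=> //; rewrite -lee_fin dom_fineK.
Qed.

(** A linear form contributes equally to both sides, so tilting keeps the modulus. *)
Lemma strongly_convex_tilted theta x y (l : R) :
  0 <= l <= 1 -> dom h x -> dom h y ->
  let phi z := fine (h z) - dotp theta z in
  phi (l *: x + (1 - l) *: y) <=
    l * phi x + (1 - l) * phi y - l * (1 - l) / 2 * N (y - x) ^+ 2.
Proof.
move=> l01 xh yh /=; have [_] := strongly_convex_fine l01 xh yh.
by rewrite dotpDr !dotpZr; lra.
Qed.

Hypothesis h_lsc : lower_semicontinuous h.

(** Used to show that the limit of a minimizing sequence is a minimizer. If [h y] exceeded
    [<theta, y> + m + e], so would [h (u k)] for large [k]; but by then the variation of the linear
    term is at most [e / 2] and [eps k] is below [e / 2]. *)
Lemma lower_semicontinuous_tilted_cvg theta (u : nat -> 'rV[R]_n) y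
    (m : R) (eps : nat -> R) :
  (forall k, dom h (u k)) ->
  (forall k, fine (h (u k)) - dotp theta (u k) < m + eps k) ->
  eps @ \oo --> 0 -> u @ \oo --> y -> dom h y /\ fine (h y) - dotp theta y <= m.
Proof.
move=> uh um eps0 uy.
(* The bound is stated in extended reals because the finiteness of [h y] is deduced from it, with
   [e = 1]. *)
have le_eps (e : R) : 0 < e -> (h y <= (dotp theta y + m + e)%:E)%E.
  move=> e0; rewrite leNgt; apply/negP => /h_lsc[V Vy Vh].
  have [C C0 dC] := dotp_bounded theta.
  have e2 : 0 < e / 2 by rewrite divr_gt0.
  have eC : 0 < e / 2 / (C + 1) by rewrite divr_gt0// ltr_wpDl.
  have [k [uV ud ke]] : exists k, [/\ V (u k),
      `|y - u k| <= e / 2 / (C + 1) & eps k < e / 2].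
    have F : \forall k \near \oo, [/\ V (u k),
      `|y - u k| <= e / 2 / (C + 1) & eps k < e / 2].
      near=> k; split; near: k.
      - exact: uy.
      - by move/cvgrPdist_le : uy; exact.
      - exact: cvgr_lt eps0 _ e2.
    by have [k] := @filter_ex _ \oo _ _ F; exists k.
  have hk : dotp theta y + m + e < fine (h (u k)).
    by rewrite -lte_fin dom_fineK//; exact: Vh.
  have d2 : dotp theta (u k) - dotp theta y <= e / 2.
    rewrite -dotpBr; apply: le_trans (ler_norm _) _; apply: le_trans (dC _) _.
    rewrite distrC; move: ud; rewrite ler_pdivlMr ?ltr_wpDl//; apply: le_trans.
    by rewrite mulrDr mulr1 mulrC lerDl.
  by have := um k; lra.
have yh : dom h y by apply: le_lt_trans (le_eps 1 ltr01) (ltry _).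
split=> //; apply/ler_addgt0Pr => e /le_eps.
by rewrite -(dom_fineK yh) lee_fin; lra.
Unshelve. all: by end_near. Qed.

(* Completeness: by strong convexity a minimizing sequence of the tilted
   function [h - <theta, .>] is a Cauchy sequence. *)
Lemma tilted_minimizer theta : dom h !=set0 -> dom (conjugate h) theta ->
  exists2 y, dom h y & forall x, dom h x ->
    fine (h y) - dotp theta y <= fine (h x) - dotp theta x.
Proof.
move=> [x0 x0h] th.
pose phi z := fine (h z) - dotp theta z.
pose A := phi @` dom h.
have Ainf : has_inf A.
  split; first by exists (phi x0), x0.
  exists (- fine (conjugate h theta)) => _ [x xh <-].
  have := fenchel_young theta x; rewrite -(dom_fineK xh) -EFinB => fy.
  have cf : conjugate h theta \is a fin_num.
    by rewrite fin_numElt th andbT (lt_le_trans _ fy)// ltNyr.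
  by move: fy; rewrite -(fineK cf) lee_fin /phi; lra.
pose m := inf A.
have m_le x : dom h x -> m <= phi x.
  by move=> xh; apply: ge_inf; [case: Ainf|exists x].
pose eps k : R := harmonic k.
have eps_to0 : eps @ \oo --> 0 by exact: cvg_harmonic.
have /choice[u uP] : forall k, exists u, dom h u /\ phi u < m + eps k.
  move=> k; have k0 : 0 < eps k by rewrite invr_gt0.
  by have [_ [u uh <-] um] := inf_adherent k0 Ainf; exists u.
have uh k : dom h (u k) by case: (uP k).
have um k : phi (u k) < m + eps k by case: (uP k).
(* At the midpoint, [phi] is at least [m] and at most [m + (eps k + eps l) / 2] minus one eighth of
   the squared distance. *)
have N2 k l : N (u l - u k) ^+ 2 <= 4 * (eps k + eps l).
  have half01 : 0 <= (1 / 2 : R) <= 1 by apply/andP; split; lra.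
  have [zh _] := strongly_convex_fine half01 (uh k) (uh l).
  have /= := strongly_convex_tilted theta half01 (uh k) (uh l).
  have := m_le _ zh; have := um k; have := um l; rewrite /phi.
  set a := N _ ^+ 2; lra.
have [c c0 Nc] := norm_le_is_norm N_norm.
have cu : cvg (u @ \oo).
  apply/cauchy_cvgP/cauchy_exP => /= e e0.
  (* With both [eps] terms below this threshold, [4 * (eps k + eps l)] stays below
     [(e / c) ^+ 2]. *)
  have e' : 0 < (e / c) ^+ 2 / 8 by rewrite divr_gt0// exprn_gt0// divr_gt0.
  have [k ke] : exists k, forall l, (k <= l)%N ->
      eps l < (e / c) ^+ 2 / 8.
    by have [k _ ke] := cvgr_lt _ eps_to0 _ e'; exists k.
  exists (u k); exists k => // l /= kl; rewrite -ball_normE /=.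
  apply: le_lt_trans (Nc _) _; rewrite mulrC -ltr_pdivlMr// (is_normC N_norm).
  rewrite -(@ltr_pXn2r _ 2)// ?nnegrE ?is_norm_ge0 ?divr_ge0 ?ltW//.
  apply: le_lt_trans (N2 k l) _.
  by have := ke k (leqnn _); have := ke l kl; lra.
have /cvg_ex[y] := cu.
move=> /(lower_semicontinuous_tilted_cvg uh um eps_to0)[yh ym].
by exists y => // x /m_le; exact: le_trans.
Qed.

(** Compare [y] with [l *: x + (1 - l) *: y]: minimality and strong convexity, divided by [l], give
    the growth with factor [1 - l], and [l] is then taken small. *)
Lemma tilted_minimizer_growth theta y : dom h y ->
  (forall x, dom h x -> fine (h y) - dotp theta y <= fine (h x) - dotp theta x) ->
  forall x, dom h x ->
    fine (h y) - dotp theta y + N (x - y) ^+ 2 / 2 <= fine (h x) - dotp theta x.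
Proof.
move=> yh ymin x xh; apply/ler_addgt0Pr => e e0.
set a := N _ ^+ 2; have a0 : 0 <= a by exact: sqr_ge0.
(* Chosen so that [l * a <= e], which absorbs the loss [l * a / 2]; the [+ 1] covers [a = 0]. *)
pose l := Num.min 1 (e / (a + 1)).
have a1 : 0 < a + 1 by lra.
have l0 : 0 < l by rewrite lt_min ltr01 divr_gt0.
have l1 : l <= 1 by rewrite ge_min lexx.
have le : l * (a + 1) <= e by rewrite -ler_pdivlMr// ge_min lexx orbT.
have l01 : 0 <= l <= 1 by rewrite ltW.
have [zh _] := strongly_convex_fine l01 xh yh.
have /= := strongly_convex_tilted theta l01 xh yh; have := ymin _ zh.
rewrite (is_normC N_norm) -/a.
set p := fine (h y) - _; set q := fine (h x) - _; set r := fine _ - _ => pr rle.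
have : l * (p + a / 2) <= l * (q + e).
  have : l * l * a <= l * e by rewrite -mulrA ler_wpM2l ?ltW//; nra.
  by have := mulr_gt0 l0 e0; nra.
by rewrite ler_pM2l.
Qed.

Lemma conjugate_minimizer theta y : dom h y ->
  (forall x, dom h x -> fine (h y) - dotp theta y <= fine (h x) - dotp theta x) ->
  conjugate h theta = (dotp theta y - fine (h y))%:E.
Proof.
move=> yh ymin; apply/eqP; rewrite eq_le; apply/andP; split; last first.
  by rewrite EFinB dom_fineK//; exact: fenchel_young.
apply: ge_ereal_sup => _ [x _ <-].
have [xh|] := boolP (h x < +oo)%E; last first.
  by rewrite -leNgt leye_eq => /eqP ->; rewrite addeNy leNye.
by rewrite -(dom_fineK xh) -EFinB lee_fin; have := ymin x xh; lra.
Qed.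

End Conjugate.

(** * Gradient of the conjugate *)

Lemma derive_quadratic_bound {R : realType} {V : normedModType R} (F : V -> R)
    (a v : V) (d K : R) :
  (forall t, `|F (t *: v + a) - F a - t * d| <= K * t ^+ 2) -> 'D_v F a = d.
Proof.
move=> FK; apply: cvg_lim => //; apply/cvgrPdist_le => e e0.
(* The hypothesis at [t = 1] forces the sign of [K]. *)
have K0 : 0 <= K.
  by have := le_trans (normr_ge0 _) (FK 1); rewrite expr1n mulr1.
have eK : 0 < e / (K + 1) by rewrite divr_gt0// ltr_wpDl.
near=> t.
have t0 : t != 0 by near: t; exact: nbhs_dnbhs_neq.
have te : `|t| <= e / (K + 1).
  by near: t; apply: dnbhs0_le.
(* Multiplied by [|t|], the error of the difference quotient is the assumed remainder, at most
   [K * t ^+ 2]. *)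
rewrite /= distrC -(ler_pM2l (x := `|t|)) ?normr_gt0// -normrM.
rewrite mulrBr [_ *: _]/(_ * _) mulrA divff// mul1r.
apply: le_trans (FK t) _.
rewrite -(real_normK (num_real t)) expr2 mulrCA ler_wpM2l//.
move: te; rewrite ler_pdivlMr ?ltr_wpDl// mulrDr mulr1 mulrC.
by have := normr_ge0 t; lra.
Unshelve. all: by end_near. Qed.

(* The smoothness of the conjugate is obtained from the sandwich
   [<v, y> t <= h^*(theta + t v) - h^*(theta) <= <v, y> t + C t^2]. *)
Lemma grad_conjugate_minimizer {R : realType} {n : nat} (N : 'rV[R]_n -> R)
    (h : 'rV[R]_n -> \bar R) (theta : 'rV[R]_n) :
  is_norm N -> proper_valued h -> strongly_convex N h ->
  lower_semicontinuous h -> dom h !=set0 -> dom (conjugate h) = setT ->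
  let y := grad (conjugate h) theta in
  dom h y /\ forall x, dom h x ->
    fine (h y) - dotp theta y + N (x - y) ^+ 2 / 2 <= fine (h x) - dotp theta x.
Proof.
move=> Nn hp hc hl h0 hT.
have tT t : dom (conjugate h) t by rewrite hT.
have [y yh ymin] := tilted_minimizer Nn hp hc hl h0 (tT theta).
have ygrow := tilted_minimizer_growth Nn hp hc yh ymin.
suff -> : grad (conjugate h) theta = y by [].
apply/rowP => i; rewrite mxE -dotp_delta; set v := delta_mx 0 i.
have [C C0 dC] := dotp_is_norm_bounded Nn v.
apply: (@derive_quadratic_bound _ _ _ _ _ _ (C ^+ 2 / 2)) => t /=.
rewrite (conjugate_minimizer hp yh ymin) /=.
(* Minimality of [z] for the perturbed slope, tested at [y], is the lower half of the sandwich;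
   growth around [y], tested at [z], is the upper half. *)
have [z zh zmin] := tilted_minimizer Nn hp hc hl h0 (tT (t *: v + theta)).
rewrite (conjugate_minimizer hp zh zmin) /=.
have zy := zmin y yh; have yz := ygrow z zh; have vzy := dC (z - y).
rewrite !dotpDl !dotpZl in zy *; rewrite dotpBr in vzy.
set b := N (z - y) in yz vzy; set d := dotp v z - dotp v y in vzy.
(* Young's inequality: the term [b ^+ 2 / 2] is exactly what the growth around [y] pays for. *)
have td : t * d <= C ^+ 2 / 2 * t ^+ 2 + b ^+ 2 / 2.
  have td1 : t * d <= `|t| * (C * b).
    by apply: le_trans (ler_norm _) _; rewrite normrM ler_wpM2l.
  have := real_normK (num_real t).
  by have := sqr_ge0 (C * `|t| - b); nra.
have tC : 0 <= C ^+ 2 / 2 * t ^+ 2 by rewrite mulr_ge0 ?divr_ge0 ?sqr_ge0.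
rewrite /d mulrBr in td; rewrite ler_norml; apply/andP; split; lra.
Qed.

(** * First-order inequalities for convex and for smooth functions *)

Section Gradient.
Context {R : realType} {n : nat} (f : 'rV[R]_n -> \bar R).
Implicit Types (x y z d : 'rV[R]_n).

Lemma derive_dotp_grad x d : differentiable (fine \o f) x ->
  'D_d (fine \o f) x = dotp (grad f x) d.
Proof.
move=> fx; rewrite deriveE// {1}[d]row_sum_delta linear_sum/=.
by apply: eq_bigr => i _; rewrite linearZ/= mxE deriveE// mulrC.
Qed.

(** The difference quotients of the restriction to the line are those of [f] at [x + t *: d] in
    direction [d]. *)
Lemma is_derive_line x d (t : R) : differentiable (fine \o f) (x + t *: d) ->
  is_derive t 1 (fun s : R => fine (f (x + s *: d)))
    (dotp (grad f (x + t *: d)) d).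
Proof.
move=> fx; have fd := @diff_derivable _ _ _ _ _ d fx.
have E : (fun s : R => s^-1 *:
    (((fun r : R => fine (f (x + r *: d))) \o shift t) (s *: 1) -
     fine (f (x + t *: d)))) =
  (fun s : R => s^-1 *:
    (((fine \o f) \o shift (x + t *: d)) (s *: d) - (fine \o f) (x + t *: d))).
  apply/funext => s /=; congr (_ *: (fine (f _) - _)).
  by rewrite [s *: 1]mulr1 scalerDl addrCA.
split; first by rewrite /derivable E.
by rewrite /derive E -/(derive _ _ _) derive_dotp_grad.
Qed.

Lemma differentiable_at_fin_num x : differentiable_at f x -> f x \is a fin_num.
Proof. by case=> /nbhs_singleton. Qed.

(** Convexity bounds the difference quotient from [x] towards [z] by [f z - f x] for every [t] in
    (0, 1]; the bound passes to the limit from the right. *)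
Lemma convex_gradient_le x z :
  proper_valued f -> convex_fun f -> differentiable_at f x ->
  f z \is a fin_num -> fine (f x) + dotp (grad f x) (z - x) <= fine (f z).
Proof.
move=> fp fc fx fz; have fxfin := differentiable_at_fin_num fx.
case: fx => _ fd; rewrite -derive_dotp_grad// addrC -lerBrDr.
have := cvg_dnbhs_at_right (@diff_derivable _ _ _ _ _ (z - x) fd).
move/cvgr_to_le; apply; near=> t.
have t0 : 0 < t by near: t; exact: nbhs_right_gt.
have t1 : t <= 1 by near: t; exact: nbhs_right_le.
have t01 : 0 <= t <= 1 by rewrite ltW.
rewrite /= [_ *: _]/(_ * _) ler_pdivrMl//.
have -> : t *: (z - x) + x = t *: z + (1 - t) *: x.
  by rewrite scalerBr scalerBl scale1r -addrA [- _ + x]addrC.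
have := fc z x t t01; rewrite -(fineK fz) -(fineK fxfin) -!EFinM -EFinD => fle.
have wf : f (t *: z + (1 - t) *: x) \is a fin_num.
  by rewrite fin_numElt fp (le_lt_trans fle)// ltry.
by move: fle; rewrite -(fineK wf) lee_fin/=; lra.
Unshelve. all: by end_near. Qed.

(** Instead of integrating the gradient along the segment, subtract from [f] its linear part and the
    quadratic [K / 2 * s ^+ 2]. The resulting [G] has nonpositive derivative inside [0, 1], so the
    mean value theorem gives [G 1 <= G 0], which is the claim. *)
Lemma smooth_bregman_le (X : set 'rV[R]_n) (N : 'rV[R]_n -> R) (L : R) x y :
  is_norm N -> convex_set X -> (forall z, X z -> differentiable_at f z) ->
  (forall z w, X z -> X w -> dual_norm N (grad f z - grad f w) <= L * N (z - w)) ->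
  X x -> X y ->
  fine (f y) - fine (f x) - dotp (grad f x) (y - x) <= L / 2 * N (y - x) ^+ 2.
Proof.
move=> Nn Xc fX fL Xx Xy; set d := y - x; set b := dotp (grad f x) d.
set K := L * N d ^+ 2.
have XI (t : R) : t \in `[0, 1]%R -> X (x + t *: d).
  rewrite in_itv/= => /andP[t0 t1].
  suff -> : x + t *: d = t *: y + (1 - t) *: x.
    exact/set_mem/(Xc y x (Itv01 t0 t1) (mem_set Xy) (mem_set Xx)).
  by rewrite scalerBl scalerBr scale1r addrCA.
pose F (s : R) := fine (f (x + s *: d)).
pose G : R -> R := F - b *: id - (K / 2) *: id ^+ 2.
pose dG (s : R) := dotp (grad f (x + s *: d)) d - b - K * s.
have GD (t : R) : t \in `[0, 1]%R -> is_derive t 1 G (dG t).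
  move=> /XI/fX[_ /is_derive_line fd]; apply: is_derive_eq.
  by rewrite /dG /GRing.scale /=; field.
have Gc : {within `[0, 1], continuous G}.
  by apply: derivable_within_continuous => t /GD[].
have GD' (t : R) : t \in `]0, 1[%R -> is_derive t 1 G (dG t).
  by move=> /subset_itv_oo_cc/GD.
have [c /[dup] /subset_itv_oo_cc c01' c01] := MVT ltr01 GD' Gc.
rewrite subr0 mulr1 /G /F !fctE /= !scale0r !scale1r addr0 subrKC => E.
(* The gradients at [x + c *: d] and [x] differ by at most [L * c * N d] in dual norm; pairing with
   [d] yields at most [K * c]. *)
have dd : dG c <= 0.
  rewrite /dG subr_le0 -dotpBl; apply: le_trans (dotp_le_dual_norm Nn _ _) _.
  apply: le_trans (ler_wpM2r (is_norm_ge0 Nn d) (fL _ _ (XI _ c01') Xx)) _.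
  case: (Nn) => _ NZ _; rewrite addrC addKr NZ ger0_norm ?(itvP c01)//.
  by rewrite /K; lra.
by move: E dd; rewrite /K /GRing.scale /= expr0n/= expr1n; lra.
Qed.

End Gradient.

(** * Descent along the iterates and the convergence rate *)

Lemma bregman_sub_fine {R : realType} {n : nat} (g : 'rV[R]_n -> \bar R) y x v :
  g y \is a fin_num -> g x \is a fin_num ->
  bregman_sub g y x v = (fine (g y) - fine (g x) - dotp v (y - x))%:E.
Proof. by move=> /fineK gy /fineK gx; rewrite /bregman_sub -gy -gx -!EFinB. Qed.

Theorem theorem4p3 (R : realType) (n : nat)
    (X : set 'rV[R]_n) (N : 'rV[R]_n -> R) (h f : 'rV[R]_n -> \bar R) (L : R)
    (fstar : \bar R) (xstar : 'rV[R]_n)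
    (gamma : nat -> R) (x theta : nat -> 'rV[R]_n)
    (X_nonempty : X !=set0) (X_closed : closed X) (X_convex : convex_set X)
    (N_norm : is_norm N)
    (h_regularizer : regularizer X h) (h_strongly_convex : strongly_convex N h)
    (L_gt0 : 0 < L)
    (f_proper : proper_valued f) (f_convex : convex_fun f)
    (f_C1 : continuously_differentiable_on X f)
    (f_smooth : forall y z, X y -> X z ->
       dual_norm N (grad f y - grad f z) <= L * N (y - z))
    (xstar_X : X xstar) (f_xstar : f xstar = fstar)
    (fstar_min : forall y, X y -> (fstar <= f y)%E)
    (xstar_dom : dom h xstar)
    (gamma_gt0 : forall t, (1 <= t)%N -> 0 < gamma t)
    (iterates : umd_iterates X h (fun t => - gamma t *: grad f (x t)) x theta) :
  let star t := ((gamma t)%:E * bregman f (x t.+1) (x t) <=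
                 bregman_sub h (x t.+1) (x t) (theta t))%E in
  [/\ forall t, (1 <= t)%N -> gamma t <= 1 / L -> star t,
      (forall t, (1 <= t)%N -> star t) ->
        forall T, (1 <= T)%N ->
          (f (x T.+1) - fstar <=
           ((\sum_(1 <= t < T.+1) gamma t)^-1)%:E
           * bregman_sub h xstar (x 1%N) (theta 1%N))%E &
      (forall t, (1 <= t)%N -> gamma t = 1 / L) ->
        forall T, (1 <= T)%N ->
          (f (x T.+1) - fstar <=
           L%:E * bregman_sub h xstar (x 1%N) (theta 1%N) * (T%:R^-1)%:E)%E].
Proof.
move=> star.
have [hp _ hl hX hT] := h_regularizer.
have domX z : dom h z -> X z by rewrite -hX; exact: subset_closure.
have h0 : dom h !=set0 by exists xstar.
have ffin z : X z -> f z \is a fin_num.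
  by case: f_C1 => fX _ /fX/differentiable_at_fin_num.
(* The growth inequality at the minimizer [x t], rewritten as a lower bound on the Bregman
   divergence of [h]. *)
have iterP t : (1 <= t)%N -> dom h (x t) /\ forall z, dom h z ->
    N (z - x t) ^+ 2 / 2 <=
    fine (h z) - fine (h (x t)) - dotp (theta t) (z - x t).
  move=> /iterates[-> _].
  have [yh yle] := grad_conjugate_minimizer (theta t) N_norm hp
    h_strongly_convex hl h0 hT.
  by split=> // z /yle; rewrite dotpBr; lra.
have xh t : (1 <= t)%N -> dom h (x t) by move=> /iterP[].
have xX t : (1 <= t)%N -> X (x t) by move=> /xh/domX.
pose F z := fine (f z).
pose D z t := fine (h z) - fine (h (x t)) - dotp (theta t) (z - x t).
have hD z t : (1 <= t)%N -> dom h z ->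
    bregman_sub h z (x t) (theta t) = (D z t)%:E.
  by move=> t1 zh; rewrite bregman_sub_fine ?dom_fin_num//; exact: xh.
have D_ge z t : (1 <= t)%N -> dom h z -> N (z - x t) ^+ 2 / 2 <= D z t.
  by move=> t1 zh; have [_] := iterP t t1; exact.
have D_ge0 z t : (1 <= t)%N -> dom h z -> 0 <= D z t.
  by move=> t1 zh; apply: le_trans _ (D_ge _ _ t1 zh); rewrite divr_ge0 ?sqr_ge0.
have starE t : (1 <= t)%N -> star t <->
    gamma t * (F (x t.+1) - F (x t) - dotp (grad f (x t)) (x t.+1 - x t)) <=
    D (x t.+1) t.
  move=> t1; rewrite /star hD//; last exact: xh.
  by rewrite /bregman bregman_sub_fine ?lee_fin; try exact: ffin (xX _ _).
have star_small t : (1 <= t)%N -> gamma t <= 1 / L -> star t.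
  move=> t1 gL; apply/starE => //.
  have [fX _] := f_C1.
  have Df := smooth_bregman_le N_norm X_convex fX f_smooth (xX t t1)
    (xX t.+1 isT).
  apply: le_trans _ (D_ge (x t.+1) t t1 (xh t.+1 isT)).
  apply: le_trans (ler_wpM2l (ltW (gamma_gt0 t t1)) Df) _.
  rewrite mulrA [leRHS]mulrC ler_wpM2r ?sqr_ge0//.
  by move: gL; rewrite ler_pdivlMr//; lra.
(* Three-point identity: [<theta_{t+1} - theta_t, z - x_{t+1}>] equals
   [D z t - D z t.+1 - D (x t.+1) t]. *)
have step t z : (1 <= t)%N -> star t -> dom h z ->
    gamma t * (F (x t.+1) - F z) <= D z t - D z t.+1.
  move=> t1 /(starE t t1) st zh; have [fX _] := f_C1.
  have gt0 := ltW (gamma_gt0 t t1).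
  have fz := ler_wpM2l gt0 (convex_gradient_le f_proper f_convex
    (fX _ (xX t t1)) (ffin _ (domX _ zh))).
  have [_ /(_ z (domX _ zh))] := iterates t t1.
  move: st fz; rewrite /D /F !dotpBl dotpZl !dotpBr; lra.
(* Step [t + 1] with [z] equal to the current iterate, whose divergence from itself vanishes. The
   shift makes the index positive for every [t]. *)
have value t : (forall s, (1 <= s)%N -> star s) ->
    F (x t.+2) <= F (x t.+1).
  move=> st; have := step t.+1 (x t.+1) isT (st t.+1 isT) (xh t.+1 isT).
  have -> : D (x t.+1) t.+1 = 0.
    by rewrite /D !subrr dotp0r subrr.
  have := D_ge0 (x t.+1) t.+2 isT (xh t.+1 isT) => D0 le.
  rewrite -subr_le0 -(pmulr_rle0 _ (gamma_gt0 t.+1 isT)).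
  by apply: le_trans le _; lra.
have rate : (forall t, (1 <= t)%N -> star t) -> forall T, (1 <= T)%N ->
    (f (x T.+1) - fstar <=
      ((\sum_(1 <= t < T.+1) gamma t)^-1)%:E
      * bregman_sub h xstar (x 1%N) (theta 1%N))%E.
  move=> st T T1.
  (* Here [T = k + 1]. In the induction step, monotonicity of the values allows the previous sum of
     step-sizes to multiply the newest gap. *)
  have tele k : (\sum_(1 <= t < k.+2) gamma t) * (F (x k.+2) - F xstar) <=
      D xstar 1 - D xstar k.+2.
    elim: k => [|k IH].
      by rewrite big_nat1; exact: step 1%N xstar isT (st 1%N isT) xstar_dom.
    rewrite big_nat_recr//= mulrDl.
    have := step k.+2 xstar isT (st k.+2 isT) xstar_dom.
    have S0 : 0 <= \sum_(1 <= t < k.+2) gamma t.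
      by rewrite big_nat_cond sumr_ge0// => t /andP[/andP[/gamma_gt0/ltW]].
    have := ler_wpM2l S0 (value k.+1 st).
    by move: IH; lra.
  case: T T1 => // T _.
  rewrite hD// -f_xstar -(fineK (ffin _ (xX T.+2 isT))).
  rewrite -(fineK (ffin _ xstar_X)) -EFinB -EFinM lee_fin ler_pdivlMl.
    by apply: le_trans (tele T) _; have := D_ge0 xstar T.+2 isT xstar_dom; lra.
  rewrite big_nat_recr//= ltr_wpDl ?gamma_gt0//.
  by rewrite big_nat_cond sumr_ge0// => t /andP[/andP[/gamma_gt0/ltW]].
split=> // gL T T1.
have st t : (1 <= t)%N -> star t by move=> t1; apply: star_small; rewrite ?gL.
have -> : (L%:E * bregman_sub h xstar (x 1%N) (theta 1%N) * (T%:R^-1)%:E =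
    ((\sum_(1 <= t < T.+1) gamma t)^-1)%:E
     * bregman_sub h xstar (x 1%N) (theta 1%N))%E; last exact: rate.
rewrite hD// -!EFinM mulrAC -invf_div; congr ((_^-1 * _)%:E).
(* The step-sizes add up to [T / L], whose inverse is the factor [L / T]. *)
rewrite (eq_big_nat _ _ (F2 := fun=> L^-1)) => [|t /andP[t1 _]].
  by rewrite sumr_const_nat subn1 mulr_natl.
by rewrite gL// div1r.
Qed.
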